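(* Let $(U,\|\cdot\|_U)$, $(Z,\|\cdot\|_Z)$ be Banach spaces, let $(\Xi,\mathcal A)$ be a measurable space with a sigma-finite measure $\mu$, and let $\mathbb P$ be a probability measure on $(\Xi,\mathcal A)$ that is absolutely continuous with respect to $\mu$, with density $\rho = d\mathbb P/d\mu$. Let $f_0: Z\to\overline{\mathbb R}$, $s:\Xi\times Z\to U$, $g:U\to\overline{\mathbb R}$ satisfy Assumptions (S) and (FG) of the context. Fix $1\le q\le\infty$, let $T = L^q(\Xi,\mathcal A,\mu)$, and let $\mathrm P$ be the set of probability densities defined in the context. Let $(\rho_\epsilon)_{\epsilon>0}\subset \mathrm P\cap T$ be probability densities converging in $T$, as $\epsilon\downarrow 0$, to $\rho\in \mathrm P\cap T$. Let $(\theta_\epsilon)_{\epsilon>0}\subset(0,\infty)$ with $\theta_\epsilon\to\infty$ as $\epsilon\downarrow0$. If $q\in[1,\infty)$, assume $$\lim_{\epsilon\downarrow 0}\theta_\epsilon\|\rho_\epsilon-\rho\|_{L^q}^q = 0,$$ and if $q=\infty$, assume $$\lim_{\epsilon\downarrow 0}\theta_\epsilon\|\rho_\epsilon-\rho\|_{L^\infty} = 0.$$ Finally, assume that for all $z\in Z$, $g(s(\cdot,z))\in L^r(\Xi,\mathcal A,\mu)$, where $1/r+1/q=1$. Define $\Phi,\Phi_\epsilon: Z\times T\to\overline{\mathbb R}$ by $$\Phi(z,t)=\begin{cases} f_0(z)+\int_\Xi g(s(\xi,z))(\rho(\xi)+t(\xi))\,d\mu(\xi), & t(\xi)=0 \ \mu\text{-a.e.},\\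 \infty,&\text{else,}\end{cases}$$ $$\Phi_\epsilon(z,t)= f_0(z)+\int_\Xi g(s(\xi,z))(\rho_\epsilon(\xi)+t(\xi))\,d\mu(\xi)+\frac{\theta_\epsilon}{q}\|t\|_{L^q}^q+\iota_{\mathrm P}(\rho_\epsilon+t),$$ where for $q=\infty$ the term $\frac{1}{q}\|t\|_{L^q}^q$ is replaced by $\|t\|_{L^\infty}$. Then $\Phi_\epsilon$ $\Gamma_s$-converges to $\Phi$ on $Z\times T$ as $\epsilon\downarrow 0$.
   Context: $\overline{\mathbb R}=\mathbb R\cup\{-\infty,\infty\}$. Arrows $\to$ and $\rightharpoonup$ denote strong (norm) and weak convergence. ''Sequences'' are families indexed by $\epsilon>0$, with limits as $\epsilon\downarrow0$. Probability densities: $\mathrm P=\{\rho:\Xi\to[0,\infty) \mid \rho\in L^\infty(\Xi;\mathbb R),\ \int_\Xi\rho\,d\mu=1\}$ (with $L^\infty$ taken with respect to $\mu$). Indicator: $\iota_{\mathrm P}(h)=0$ if $h\in \mathrm P$ and $\infty$ otherwise. Assumption (S): (1) $s(\cdot,z):\Xi\to U$ is $\mathcal A$-measurable for all $z\in Z$. (2) If $z_\epsilon\rightharpoonup z$ in $Z$ as $\epsilon\downarrow0$, then $s(\xi,z_\epsilon)\rightharpoonup s(\xi,z)$ in $U$ for $\mu$-a.e. $\xi\in\Xi$. Assumption (FG): (1) $f_0$ is proper: $f_0(z)>-\infty$ for all $z\in Z$ and $f_0(z)<\infty$ for some $z\in Z$. (2) $f_0$ and $g$ are weakly sequentially lower semicontinuous: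 $z_\epsilon\rightharpoonup z$ in $Z$ implies $\liminf_{\epsilon\downarrow0}f_0(z_\epsilon)\ge f_0(z)$, and $u_\epsilon\rightharpoonup u$ in $U$ implies $\liminf_{\epsilon\downarrow0}g(u_\epsilon)\ge g(u)$. (3) There exists $\gamma\in\mathbb R$ such that $g(u)\ge\gamma$ for all $u\in U$. $\Gamma_s$-convergence: for a Banach space $X$ and maps $h,h_\epsilon:X\to\overline{\mathbb R}$ ($\epsilon>0$), $h_\epsilon$ $\Gamma_s$-converges to $h$ as $\epsilon\downarrow0$ if (i) for every $x\in X$ there exists $(x_\epsilon)_{\epsilon>0}$ with $x_\epsilon\to x$ and $\limsup_{\epsilon\downarrow0}h_\epsilon(x_\epsilon)\le h(x)$; and (ii) for all $(x_\epsilon)_{\epsilon>0}$ with $x_\epsilon\to x$ (strongly), $\liminf_{\epsilon\downarrow0}h_\epsilon(x_\epsilon)\ge h(x)$. Here $X=Z\times T$ with the product norm topology. *)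

(* Defs.v *)
From HB Require Import structures.
From mathcomp Require Import all_boot all_order all_algebra.
From mathcomp Require Import all_classical all_reals all_analysis.
From mathcomp Require Import measurable_realfun ess_sup_inf.

Set Implicit Arguments.
Unset Strict Implicit.
Unset Printing Implicit Defensive.

Import Order.TTheory GRing.Theory Num.Theory.
Import numFieldNormedType.Exports.

Local Open Scope classical_set_scope.
Local Open Scope ring_scope.

(* The library leaves the quotient [LspaceType mu p1] (classes of p-integrable
   functions modulo a.e. equality) without algebraic or topological structure;
   this section makes it a normed module for the norm 'N[mu]_p. *)
Section Lspace_normedMod.
Context (d : measure_display) (T : measurableType d) (R : realType).
Variables (mu : {measure set T -> \bar R}) (p : \bar R) (p1 : (1 <= p)%E).

Local Notation L := (LspaceType mu p1).
Local Notation fL := (LfunType mu p1).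
Implicit Types (u v w : L) (f g : fL).

Local Open Scope quotient_scope.

HB.instance Definition _ := gen_eqMixin L.
HB.instance Definition _ := gen_choiceMixin L.

Lemma eq_ae_Lnorm (f g : T -> R) :
  measurable_fun [set: T] f -> measurable_fun [set: T] g ->
  f = g %[ae mu] -> 'N[mu]_p[EFin \o f]%E = 'N[mu]_p[EFin \o g]%E.
Proof.
move=> mf mg fg; rewrite unlock; case: p p1 => [r r1|_|//].
- congr (_ `^ _)%E; apply: ae_eq_integral => //.
  + apply: (@measurableT_comp _ _ _ _ _ _ (@poweR R ^~ r)).
      exact: measurable_poweR.
    by apply: measurableT_comp => //; exact/measurable_EFinP.
  + apply: (@measurableT_comp _ _ _ _ _ _ (@poweR R ^~ r)).
      exact: measurable_poweR.
    by apply: measurableT_comp => //; exact/measurable_EFinP.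
  + by apply: filterS fg => x /[apply] /= ->.
- case: ifPn => // _; apply: eq_ess_sup.
  by apply: filterS fg => x /(_ I) /= ->.
Qed.

Lemma Lspace_measurable u : measurable_fun [set: T] (u : T -> R).
Proof. exact: (@measurable_funPT _ _ _ _ (repr (u : {mfun_ mu, T >-> measurableTypeR R}))). Qed.

Lemma Lspace_Lfun u : (u : T -> R) \in Lfun mu p.
Proof.
by apply/andP; split; rewrite inE/=;
  [exact: Lspace_measurable|exact: Lebesgue_finite].
Qed.

Definition Lspace_repr u : fL := Lfun_Sub p1 (Lspace_Lfun u).

Lemma Lfun_mfunR f : (f : T -> measurableTypeR R) \in mfun.
Proof. by rewrite inE; exact: (@measurable_funPT _ _ _ _ f). Qed.

Definition Lfun_class f : {mfun_ mu, T >-> measurableTypeR R} :=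
  \pi_{mfun_ mu, T >-> measurableTypeR R} (mfun_Sub (Lfun_mfunR f)).

Lemma Lfun_classE f : Lfun_class f = f %[ae mu].
Proof.
have : repr (Lfun_class f) = mfun_Sub (Lfun_mfunR f)
    %[mod @aeEqMfun _ _ R T (measurableTypeR R) mu].
  by rewrite reprK.
by move=> /eqmodP/asboolP.
Qed.

Lemma Lfun_class_finite f : finite_norm mu p (Lfun_class f).
Proof.
rewrite /finite_norm (@eq_ae_Lnorm _ f); last exact: Lfun_classE.
- exact: Lfunction_finite.
- exact: (@measurable_funPT _ _ _ _ (repr (Lfun_class f))).
- exact: measurable_funPT.
Qed.

HB.instance Definition _ f :=
  isFinLebesgue.Build d T R mu p p1 (Lfun_class f) (Lfun_class_finite f).

Definition Lspace_pi f : L := Lfun_class f.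

Lemma Lspace_piE f : Lspace_pi f = f %[ae mu].
Proof. exact: Lfun_classE. Qed.

Lemma Lspace_eqP u v : u = v %[ae mu] -> u = v.
Proof.
move=> uv.
have : (u : {mfun_ mu, T >-> measurableTypeR R}) = v.
  by rewrite -[LHS]reprK -[RHS]reprK; apply/eqmodP/asboolP.
case: u v {uv} => [u [[pu]]] [v [[pv]]] /= uv.
by case: _ / uv in pv *; rewrite (Prop_irrelevance pu pv).
Qed.

Lemma Lspace_pi_eq f g : f = g %[ae mu] -> Lspace_pi f = Lspace_pi g.
Proof.
move=> fg; apply: Lspace_eqP.
apply: filterS3 (Lspace_piE f) (Lspace_piE g) fg => x h1 h2 h3 _.
by rewrite (h1 I) (h2 I) (h3 I).
Qed.

Lemma Lspace_reprK u : Lspace_pi (Lspace_repr u) = u.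
Proof. by apply: Lspace_eqP; exact: Lspace_piE. Qed.

Definition Lspace_zero : L := Lspace_pi 0.
Definition Lspace_opp u : L := Lspace_pi (- Lspace_repr u).
Definition Lspace_add u v : L := Lspace_pi (Lspace_repr u + Lspace_repr v).
Definition Lspace_scale (a : R) u : L := Lspace_pi (a *: Lspace_repr u).

Lemma Lspace_addrA : associative Lspace_add.
Proof.
move=> u v w; apply: Lspace_pi_eq.
have := Lspace_piE (Lspace_repr v + Lspace_repr w).
apply: filterS2 (Lspace_piE (Lspace_repr u + Lspace_repr v)) => x h1 h2 _.
apply: (etrans (congr1 (+%R (u x)) (h2 I))); rewrite addrA.
exact: (congr1 (+%R^~ (w x)) (esym (h1 I))).
Qed.

Lemma Lspace_addrC : commutative Lspace_add.
Proof. by move=> u v; rewrite /Lspace_add addrC. Qed.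

Lemma Lspace_add0r : left_id Lspace_zero Lspace_add.
Proof.
move=> u; rewrite -[RHS]Lspace_reprK; apply: Lspace_pi_eq.
apply: filterS (Lspace_piE 0) => x h _.
by apply: (etrans (congr1 (+%R^~ (u x)) (h I))); rewrite add0r.
Qed.

Lemma Lspace_addNr : left_inverse Lspace_zero Lspace_opp Lspace_add.
Proof.
move=> u; apply: Lspace_pi_eq.
apply: filterS (Lspace_piE (- Lspace_repr u)) => x h _.
by apply: (etrans (congr1 (+%R^~ (u x)) (h I))); rewrite addNr.
Qed.

HB.instance Definition _ := GRing.isZmodule.Build L
  Lspace_addrA Lspace_addrC Lspace_add0r Lspace_addNr.

Lemma Lspace_scalerA a b u :
  Lspace_scale a (Lspace_scale b u) = Lspace_scale (a * b) u.
Proof.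
apply: Lspace_pi_eq.
apply: filterS (Lspace_piE (b *: Lspace_repr u)) => x h _.
by apply: (etrans (congr1 ( *%R a) (h I))); exact: mulrA.
Qed.

Lemma Lspace_scale1r : left_id 1 Lspace_scale.
Proof. by move=> u; rewrite /Lspace_scale scale1r Lspace_reprK. Qed.

Lemma Lspace_scalerDr : right_distributive Lspace_scale +%R.
Proof.
move=> a u v; apply: Lspace_pi_eq.
have h1 := Lspace_piE (Lspace_repr u + Lspace_repr v).
have h2 := Lspace_piE (a *: Lspace_repr u).
have h3 := Lspace_piE (a *: Lspace_repr v).
apply: filterS3 h1 h2 h3 => x h1 h2 h3 _.
apply: (etrans (congr1 ( *%R a) (h1 I))); apply: (etrans (mulrDr _ _ _)).
exact: (esym (f_equal2 +%R (h2 I) (h3 I))).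
Qed.

Lemma Lspace_scalerDl u : {morph Lspace_scale^~ u : a b / a + b}.
Proof.
move=> a b; apply: Lspace_pi_eq.
have h2 := Lspace_piE (a *: Lspace_repr u).
have h3 := Lspace_piE (b *: Lspace_repr u).
apply: filterS2 h2 h3 => x h2 h3 _.
apply: (etrans (mulrDl _ _ _)).
exact: (esym (f_equal2 +%R (h2 I) (h3 I))).
Qed.

HB.instance Definition _ := GRing.Zmodule_isLmodule.Build R L
  Lspace_scalerA Lspace_scale1r Lspace_scalerDr Lspace_scalerDl.

Definition Lspace_norm u : R := fine 'N[mu]_p[EFin \o u].

Lemma Lspace_norm_pi f : Lspace_norm (Lspace_pi f) = fine 'N[mu]_p[EFin \o f].
Proof.
congr fine; apply: eq_ae_Lnorm; last exact: Lspace_piE.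
- exact: Lspace_measurable.
- exact: measurable_funPT.
Qed.

Lemma Lspace_normD u v : Lspace_norm (u + v) <= Lspace_norm u + Lspace_norm v.
Proof. by rewrite Lspace_norm_pi; exact: ler_LnormD. Qed.

Lemma Lspace_normZ (a : R) u : Lspace_norm (a *: u) = `|a| * Lspace_norm u.
Proof.
rewrite Lspace_norm_pi; apply: EFin_inj.
rewrite EFinM finite_norm_fine LnormZ.
by rewrite (finite_norm_fine (Lspace_repr u)).
Qed.

Lemma Lspace_norm_eq0 u : Lspace_norm u = 0 -> u = 0.
Proof.
move=> /(@fine_Lnormr_eq0 _ _ _ _ _ p1 (Lspace_repr u)) u0.
by rewrite -[LHS]Lspace_reprK; exact: Lspace_pi_eq.
Qed.

HB.instance Definition _ := Lmodule_isNormed.Build R L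
  Lspace_normD Lspace_normZ Lspace_norm_eq0.

End Lspace_normedMod.

Section Lspace_normedMod_lemmas.
Context (d : measure_display) (T : measurableType d) (R : realType).
Variables (mu : {measure set T -> \bar R}) (p : \bar R) (p1 : (1 <= p)%E).
Implicit Types u v : LspaceType mu p1.

Lemma LspaceD u v : (u + v : LspaceType mu p1) = (u : T -> R) \+ v %[ae mu].
Proof. exact: Lspace_piE. Qed.

Lemma LspaceN u : (- u : LspaceType mu p1) = \- (u : T -> R) %[ae mu].
Proof. exact: Lspace_piE. Qed.

Lemma Lspace0 : (0 : LspaceType mu p1) = cst 0 %[ae mu].
Proof. exact: Lspace_piE. Qed.

Lemma Lspace_normE u : `|u|%:E = 'N[mu]_p[EFin \o u]%E.
Proof. exact: (finite_norm_fine (Lspace_repr u)). Qed.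

End Lspace_normedMod_lemmas.

(* Families [(x_e)_{e > 0}] are functions [R -> X]; limits as [e] decreases to 0
   are taken along [0^'+], so the values at [e <= 0] are irrelevant. *)
Section convergences.
Context (R : realType).

Definition weak_cvg (X : normedModType R) (x_ : R -> X) (x : X) : Prop :=
  forall phi : {linear X -> R^o}, continuous phi ->
    phi (x_ e) @[e --> 0^'+] --> phi x.

Definition weakly_seq_lsc (X : normedModType R) (h : X -> \bar R) : Prop :=
  forall (x_ : R -> X) (x : X), weak_cvg x_ x ->
    (h x <= limf_einf (h \o x_) (0 : R)^'+)%E.

Definition Gamma_s_cvg (X : normedModType R) (h_ : R -> X -> \bar R)
    (h : X -> \bar R) : Prop :=
  (forall x : X, exists2 x_ : R -> X, x_ @ 0^'+ --> x &
     (limf_esup (fun e => h_ e (x_ e)) (0 : R)^'+ <= h x)%E) /\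
  (forall (x : X) (x_ : R -> X), x_ @ 0^'+ --> x ->
     (h x <= limf_einf (fun e => h_ e (x_ e)) (0 : R)^'+)%E).

End convergences.

Section setting.
Context (d : measure_display) (Xi : measurableType d) (R : realType).
Variable mu : {measure set Xi -> \bar R}.

Definition assumption_S (U Z : normedModType R) (s : Xi -> Z -> U) : Prop :=
  (forall z : Z, measurable_fun [set: Xi]
     (s ^~ z : Xi -> g_sigma_algebraType (@open U))) /\
  (forall (z_ : R -> Z) (z : Z), weak_cvg z_ z ->
     {ae mu, forall xi : Xi, weak_cvg (fun e => s xi (z_ e)) (s xi z)}).

Definition assumption_FG (U Z : normedModType R) (f0 : Z -> \bar R)
    (g : U -> \bar R) : Prop :=
  [/\ (forall z, -oo < f0 z)%E /\ (exists z, f0 z < +oo)%E,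
      weakly_seq_lsc f0 /\ weakly_seq_lsc g &
      exists gamma : R, forall u, (gamma%:E <= g u)%E].

(* [Lfun mu p] is restricted to real-valued functions. *)
Definition eLfun (p : \bar R) (f : Xi -> \bar R) : Prop :=
  measurable_fun [set: Xi] f /\ ('N[mu]_p[f] < +oo)%E.

Definition prob_density (rho : Xi -> R) : Prop :=
  [/\ rho \in Lfun mu +oo%E, forall xi, 0 <= rho xi &
      (\int[mu]_xi (rho xi)%:E = 1)%E].

Variables (q : \bar R) (q1 : (1 <= q)%E).

(* A class belongs to P when it has a representative that is a probability
   density; arbitrary representatives are only nonnegative a.e. *)
Definition Pdens : set (LspaceType mu q1) :=
  [set h | exists2 rho : Xi -> R, prob_density rho & h = rho %[ae mu]].

Definition iota_P (h : LspaceType mu q1) : \bar R :=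
  if `[< Pdens h >] then 0%E else +oo%E.

Definition penalty (theta : R) (t : LspaceType mu q1) : R :=
  match q with
  | r%:E => theta / r * `|t| `^ r
  | _ => theta * `|t|
  end.

Variables (U Z : normedModType R).
Variables (f0 : Z -> \bar R) (s : Xi -> Z -> U) (g : U -> \bar R).

Definition Phi (rho : LspaceType mu q1) (x : Z * LspaceType mu q1) : \bar R :=
  let: (z, t) := x in
  if `[< {ae mu, forall xi, t xi = 0} >] then
    (f0 z + \int[mu]_xi (g (s xi z) * (rho xi + t xi)%:E))%E
  else +oo%E.

Definition Phi_eps (rho_ : R -> LspaceType mu q1) (theta_ : R -> R) (e : R)
    (x : Z * LspaceType mu q1) : \bar R :=
  let: (z, t) := x in
  (f0 z + \int[mu]_xi (g (s xi z) * (rho_ e xi + t xi)%:E)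
     + (penalty (theta_ e) t)%:E + iota_P (rho_ e + t)%R)%E.

End setting.

(* Main.v *)
Require Import Defs.
From HB Require Import structures.
From mathcomp Require Import all_boot all_order all_algebra.
From mathcomp Require Import all_classical all_reals all_analysis.
From mathcomp Require Import measurable_realfun ess_sup_inf.

(* Recovery sequence: the hypothesis on [theta_] makes the penalty of
   [rho - rho_e] vanish, so [(z, rho - rho_e)] recovers [Phi (z, 0)]. Lower
   bound: wherever [rho_e + t_e] is a probability density the integral is at
   least the lower bound of [g], so for [t <> 0] the penalty drives [Phi_eps] to
   infinity. For [t = 0] the densities [rho_e + t_e] converge to [rho] in [L^q],
   hence a.e. along a subsequence, and Fatou's lemma applies to
   [(g (s xi z_e) - gamma) (rho_e + t_e)]. *)

Set Implicit Arguments.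
Unset Strict Implicit.
Unset Printing Implicit Defensive.

Import Order.TTheory GRing.Theory Num.Theory.
Import numFieldNormedType.Exports.

Local Open Scope classical_set_scope.
Local Open Scope ring_scope.
Local Open Scope charge_scope.

(** * Lower and upper limits along a filter *)

Section limf.
Context (R : realType) (I : choiceType) (T : filteredType I) (F : set_system T).
Implicit Types (f : T -> \bar R) (a : \bar R).

Lemma limf_einf_ge f a :
  (\forall x \near F, a <= f x)%E -> (a <= limf_einf f F)%E.
Proof.
move=> Fa; rewrite limf_einfE; apply: le_ereal_sup_tmp.
exists (ereal_inf (f @` [set x | (a <= f x)%E])).
  by exists [set x | (a <= f x)%E].
by apply: le_ereal_inf_tmp => _ [x /= ax <-].
Qed.

Lemma limf_einf_gt {FF : Filter F} f a :
  (a < limf_einf f F)%E -> (\forall x \near F, a < f x)%E.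
Proof.
rewrite limf_einfE => /ereal_sup_gt[_ [V FV <-]] aV.
apply: filterS FV => x Vx; apply: lt_le_trans aV _.
by apply: ereal_inf_lbound; exists x.
Qed.

Lemma limf_esup_le f a :
  (\forall x \near F, f x <= a)%E -> (limf_esup f F <= a)%E.
Proof.
move=> Fa; rewrite limf_esupE; apply: ge_ereal_inf.
exists (ereal_sup (f @` [set x | (f x <= a)%E])).
  by exists [set x | (f x <= a)%E].
by apply: ge_ereal_sup => _ [x /= ax <-].
Qed.

End limf.

(** * Extended reals tested by the real numbers below them, and nonnegative sequences *)

Lemma lee_EFin_lt (R : realType) (x y : \bar R) :
  (forall a : R, (a%:E < x)%E -> (a%:E <= y)%E) -> (x <= y)%E.
Proof.
move=> h; rewrite leNgt; apply/negP => yx.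
case: x yx h => [x||] yx h.
- case: y yx h => [y||] yx h //.
  + have := h _ (_ : ((y + x) / 2)%:E < x%:E)%E.
    rewrite lte_fin midf_lt // lee_fin => /(_ isT).
    by rewrite leNgt midf_lt.
  + have := h (x - 1); rewrite lte_fin ltrBlDr ltrDl ltr01 => /(_ isT).
    by rewrite leeNy_eq.
- case: y yx h => [y||] // yx h.
  + have := h (y + 1); rewrite ltry => /(_ isT).
    by rewrite lee_fin gerDl leNgt ltr01.
  + by have := h 0; rewrite ltry => /(_ isT); rewrite leeNy_eq.
- by rewrite ltNge leNye in yx.
Qed.

Lemma EFin_lt_ex (R : realType) (x : \bar R) :
  (-oo < x)%E -> exists a : R, (a%:E < x)%E.
Proof.
case: x => [x||] // _; last by exists 0; rewrite ltry.
by exists (x - 1); rewrite lte_fin ltrBlDr ltrDl ltr01.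
Qed.

(** Each real below [x + y] splits into a real below [x] and one below [y], even if a summand is
    [+oo], because neither is [-oo]. Lower limits of sums thus reduce to eventual real bounds on
    each summand. *)
Lemma lee_add_EFin_lt (R : realType) (x y w : \bar R) :
  (-oo < x)%E -> (-oo < y)%E ->
  (forall a b : R, (a%:E < x)%E -> (b%:E < y)%E -> ((a + b)%:E <= w)%E) ->
  (x + y <= w)%E.
Proof.
move=> xNy yNy h; apply: lee_EFin_lt => c.
case: x xNy h => [x||] // xNy h; case: y yNy h => [y||] // yNy h.
- rewrite -EFinD lte_fin => cxy.
  pose e := (x + y - c) / 2.
  have e0 : 0 < e by rewrite divr_gt0// subr_gt0.
  have -> : c = (x - e) + (y - e).
    by rewrite addrACA -opprD -splitr opprB addrC subrK.
  by apply: h; rewrite lte_fin ltrBlDr ltrDl.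
- move=> _; have -> : c = (x - 1) + (c - (x - 1)) by rewrite addrC subrK.
  by apply: h; rewrite ?ltry// lte_fin ltrBlDr ltrDl ltr01.
- move=> _; have -> : c = (c - (y - 1)) + (y - 1) by rewrite subrK.
  by apply: h; rewrite ?ltry// lte_fin ltrBlDr ltrDl ltr01.
- move=> _; have -> : c = c + 0 by rewrite addr0.
  by apply: h; rewrite ?ltry.
Qed.

(** The convention [+oo * 0 = 0] settles [k = 0], where [a] may be infinite. For [k > 0], a real
    [c < b * k] with [0 < b < a] is eventually exceeded, since [b < a_ n] and [c / b <= k_ n] in the
    end. *)
Lemma limn_einf_mul_ge (R : realType) (a_ : nat -> \bar R) (a : \bar R)
    (k_ : nat -> R) (k : R) :
  (forall n, 0 <= a_ n)%E -> (forall n, 0 <= k_ n) -> 0 <= k ->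
  (forall b : \bar R, (b < a)%E -> \forall n \near \oo, (b < a_ n)%E) ->
  k_ @ \oo --> k ->
  (a * k%:E <= limn_einf (fun n => a_ n * (k_ n)%:E))%E.
Proof.
move=> a_ge0 k_ge0 k0 ha hk.
set L := limn_einf _.
have L0 : (0 <= L)%E.
  by apply: limf_einf_ge; apply: nearW => n; rewrite mule_ge0// lee_fin.
move: k0; rewrite le_eqVlt => /predU1P[<-|k0]; first by rewrite mule0.
rewrite -lee_pdivlMr//; apply: lee_EFin_lt => b ba.
have [b0|b0] := leP b 0.
  by rewrite (@le_trans _ _ 0%E)// ?lee_fin// mule_ge0// lee_fin invr_ge0 ltW.
rewrite lee_pdivlMr//; apply: lee_EFin_lt => c.
rewrite lte_fin => cbk; apply: limf_einf_ge.
have ck : c / b < k by rewrite ltr_pdivrMr// mulrC.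
near=> n.
apply: (@le_trans _ _ (b%:E * (k_ n)%:E)%E).
  rewrite -EFinM lee_fin mulrC -ler_pdivrMr//.
  near: n; exact: (cvgr_ge k).
apply: lee_pmul => //; rewrite ?lee_fin// ltW//.
by near: n; apply: ha.
Unshelve. all: by end_near. Qed.

(** The term of index [n] is at most the tail starting at [n], and the tails of a finite sum tend to
    0. *)
Lemma nneseries_lty_cvg0 (R : realType) (a : nat -> R) :
  (forall n, 0 <= a n) ->
  (\sum_(0 <= n <oo) (a n)%:E < +oo)%E -> a n @[n --> \oo] --> 0.
Proof.
move=> a0 aoo; apply: (@fine_cvg _ _ _ _ (EFin \o a)).
apply: (@squeeze_cvge _ _ _ _ (cst 0%E) _
  (fun N => \sum_(N <= n <oo) (a n)%:E)%E).
- apply: nearW => n /=; rewrite lee_fin a0/=.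
  rewrite (nneseries_split n 1); last by move=> k _; rewrite lee_fin.
  rewrite addn1 big_nat1 leeDl// nneseries_ge0// => k _ _.
  by rewrite lee_fin.
- exact: cvg_cst.
- by apply: (nneseries_tail_cvg aoo) => k _; rewrite lee_fin.
Qed.

(** * Almost everywhere convergence from fast convergence in norm *)

Section Lspace_subsequence.
Context (d : measure_display) (T : measurableType d) (R : realType).
Variable mu : {measure set T -> \bar R}.

(** On a space of measure zero the norm is 0 by convention, whatever [f] is, but there the
    exceptional set may be the whole space. *)
Lemma ae_le_Lnormy (f : T -> \bar R) :
  {ae mu, forall x, (`|f x| <= 'N[mu]_+oo[f])%E}.
Proof.
rewrite unlock; case: ifPn => [_|mu0]; first exact: ess_sup_ge.
exists setT; split => //; apply/eqP.
by rewrite eq_le measure_ge0 andbT leNgt.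
Qed.

(** The argument behind Riesz-Fischer: for finite [p] the sum of [|u n - v|^p] has a finite
    integral, hence is finite a.e., so its terms tend to 0. For [p = +oo] the norms bound the
    differences off a common null set. *)
Lemma Lspace_ae_cvg (p : \bar R) (p1 : (1 <= p)%E)
    (u : nat -> LspaceType mu p1) (v : LspaceType mu p1) :
  (forall n, `|u n - v| <= (2 ^ (n + 1))%:R^-1) ->
  {ae mu, forall x, u n x @[n --> \oo] --> v x}.
Proof.
move=> uv.
have eps_gt0 n : 0 < (2 ^ (n + 1))%:R^-1 :> R.
  by rewrite invr_gt0 ltr0n expn_gt0.
have eps_sum : (\sum_(0 <= n <oo) ((2 ^ (n + 1))%:R^-1)%:E < +oo :> \bar R)%E.
  have := @cvg_geometric_eseries_half R 1 0.
  move=> /cvg_lim h; under eq_eseriesr do rewrite -div1r.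
  by rewrite [X in (X < _)%E]h// ltry.
(* The representative of the class [u n - v] is the pointwise difference only a.e.; the countably
   many null sets are discarded together. *)
suff : {ae mu, forall x,
    (u n - v : LspaceType mu p1) x @[n --> \oo] --> (0 : R)}.
  have := ae_foralln (fun n => LspaceD (u n) (- v)).
  apply: filterS3 (LspaceN v) => x vN uD uv0.
  have /cvgrPdist_lt h := uv0; apply/cvgrPdist_lt => e /h.
  apply: filterS => n.
  have -> : (u n - v : LspaceType mu p1) x = u n x - v x.
    exact: (etrans (uD n I) (congr1 (+%R (u n x)) (vN I))).
  by rewrite sub0r normrN distrC.
case: p p1 u v uv => [p||] // p1 u v uv; last first.
  have : {ae mu, forall x, forall n,
      `|(u n - v : LspaceType mu p1) x| <= (2 ^ (n + 1))%:R^-1}.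
    apply: ae_foralln => n.
    apply: filterS (ae_le_Lnormy (EFin \o (u n - v : LspaceType mu p1))) => x.
    by rewrite -Lspace_normE lee_fin => /le_trans; apply; exact: uv.
  apply: filterS => x xn; apply/cvgr0Pnorm_lt => e e0.
  have := nneseries_lty_cvg0 (fun n => ltW (eps_gt0 n)) eps_sum.
  move=> /cvgr0Pnorm_lt /(_ _ e0); apply: filterS => n.
  by rewrite gtr0_norm//; apply: le_lt_trans.
have p0 : 0 < p by rewrite (lt_le_trans ltr01).
set w := fun n => u n - v.
have iw n : (\int[mu]_x (`|w n x| `^ p)%:E <= ((2 ^ (n + 1))%:R^-1)%:E)%E.
  have -> : (\int[mu]_x (`|w n x| `^ p)%:E = (`|w n| `^ p)%:E)%E.
    by rewrite -poweR_EFin Lspace_normE poweR_Lnorm ?gt_eqF.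
  rewrite lee_fin (@le_trans _ _ ((2 ^ (n + 1))%:R^-1 `^ p))//.
    apply: ge0_ler_powR; rewrite ?nnegrE ?(ltW p0) ?(ltW (eps_gt0 n))//.
    exact: uv.
  (* The bound lies in [(0, 1]] and [1 <= p], so the power [p] only decreases it. *)
  rewrite -[leRHS]powRr1 ?(ltW (eps_gt0 n))//; apply: ger_powR => //.
  by rewrite eps_gt0/= invf_le1 ?ler1n ?ltr0n expn_gt0.
have wm n : measurable_fun [set: T] (fun x => (`|w n x| `^ p)%:E).
  apply/measurable_EFinP.
  apply: (@measurableT_comp _ _ _ _ _ _ (@powR R ^~ p)) => //.
  by apply: measurableT_comp => //; exact: Lspace_measurable.
have s0 x : (0 <= \sum_(0 <= n <oo) (`|w n x| `^ p)%:E)%E.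
  by apply: nneseries_ge0 => n _ _; rewrite lee_fin powR_ge0.
have : mu.-integrable setT (fun x => \sum_(0 <= n <oo) (`|w n x| `^ p)%:E)%E.
  apply/integrableP; split.
    by apply: (@ge0_emeasurable_sum _ _ _ _
      (fun n x => (`|w n x| `^ p)%:E) xpredT).
  under eq_integral => x _ do rewrite (gee0_abs (s0 x)).
  rewrite integral_nneseries//.
  apply: le_lt_trans eps_sum; apply: lee_nneseries => //.
  by move=> n _ _; apply: integral_ge0 => x _; rewrite lee_fin powR_ge0.
move=> /integrable_ae => /(_ measurableT).
apply: filterS => x /(_ I); rewrite ge0_fin_numE// => xoo.
have := nneseries_lty_cvg0 (fun n => powR_ge0 _ _) xoo.
move=> /cvgr0Pnorm_lt h; apply/cvgr0Pnorm_lt => e e0.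
have := h _ (powR_gt0 p e0); apply: filterS => n.
rewrite ger0_norm ?powR_ge0//; apply: contraTT; rewrite -!leNgt => ew.
by apply: ge0_ler_powR; rewrite ?nnegrE ?(ltW p0) ?(ltW e0).
Qed.

End Lspace_subsequence.

(** * Integrals against probability densities and Fatou's lemma *)

Section density_integral.
Context (d : measure_display) (T : measurableType d) (R : realType).
Variable mu : {measure set T -> \bar R}.
Implicit Types (G : T -> \bar R) (k : T -> R).

Lemma prob_density_measurable k :
  prob_density mu k -> measurable_fun [set: T] k.
Proof. by case=> /andP[+ _] _ _; rewrite inE. Qed.

(* [G k] need not be integrable: only its negative part is, being dominated by
   [c k]. *)
Lemma integral_prob_density_shift G k (c : R) :
  measurable_fun [set: T] G -> prob_density mu k -> 0 <= c ->
  (forall x, (- c)%:E <= G x)%E ->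
  (\int[mu]_x ((G x + c%:E) * (k x)%:E) = \int[mu]_x (G x * (k x)%:E) + c%:E)%E.
Proof.
move=> mG kP c0 Gc.
have mk := prob_density_measurable kP; have [_ k0 k1] := kP.
pose F x := (G x * (k x)%:E)%E.
have mF : measurable_fun [set: T] F.
  by apply: emeasurable_funM => //; exact/measurable_EFinP.
have mS : measurable_fun [set: T] (fun x => (G x + c%:E) * (k x)%:E)%E.
  apply: emeasurable_funM; last exact/measurable_EFinP.
  exact: emeasurable_funD.
have mck : measurable_fun [set: T] (fun x => c%:E * (k x)%:E)%E.
  by apply: measurable_funeM; exact/measurable_EFinP.
have S0 x : (0 <= (G x + c%:E) * (k x)%:E)%E.
  rewrite mule_ge0 ?lee_fin//.
  by have := leeD2r c%:E (Gc x); rewrite -EFinD addNr.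
have ck0 x : (0 <= c%:E * (k x)%:E)%E by rewrite mule_ge0 ?lee_fin.
have Fneg x : (F^\- x <= c%:E * (k x)%:E)%E.
  rewrite funenegE ge_max ck0 andbT leeNl -mulNe -EFinN.
  by apply: lee_wpmul2r; rewrite ?lee_fin.
have ick : (\int[mu]_x (c%:E * (k x)%:E) = c%:E)%E.
  rewrite ge0_integralZl//; first by rewrite k1 mule1.
  - exact/measurable_EFinP.
  - by move=> x _; rewrite lee_fin.
have iFneg : (\int[mu]_x F^\- x)%E \is a fin_num.
  rewrite ge0_fin_numE ?integral_ge0//.
  apply: (@le_lt_trans _ _ c%:E); last by rewrite ltry.
  rewrite -ick; apply: ge0_le_integral => //.
  exact: measurable_funeneg.
(* All four terms are nonnegative, so their integrals add without integrability of [F]; the finite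
   integral of [F^\-] is then cancelled. *)
have pt x : ((G x + c%:E) * (k x)%:E + F^\- x = F^\+ x + c%:E * (k x)%:E)%E.
  have Ff : (F^\- x)%E \is a fin_num.
    rewrite ge0_fin_numE//; apply: le_lt_trans (Fneg x) _.
    by rewrite -EFinM ltry.
  rewrite muleDl// ?fin_num_adde_defl// -/(F x).
  rewrite (_ : F x = F^\+ x - F^\- x)%E; last by rewrite {1}(funeposneg F).
  by rewrite addeAC subeK.
rewrite -[LHS](addeK _ iFneg).
rewrite -ge0_integralD//; last exact: measurable_funeneg.
under eq_integral do rewrite pt.
rewrite ge0_integralD//; last exact: measurable_funepos.
by rewrite ick addeAC -integralE.
Qed.

Lemma le_integral_prob_density G k (c : R) :
  measurable_fun [set: T] G -> prob_density mu k -> 0 <= c ->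
  (forall x, (- c)%:E <= G x)%E ->
  ((- c)%:E <= \int[mu]_x (G x * (k x)%:E))%E.
Proof.
move=> mG kP c0 Gc.
have [_ k0 _] := kP.
rewrite EFinN -[leLHS]add0e leeBlDr// -integral_prob_density_shift//.
apply: integral_ge0 => x _; rewrite mule_ge0 ?lee_fin//.
by have := leeD2r c%:E (Gc x); rewrite -EFinD addNr.
Qed.

(** Adding [c] makes the integrands nonnegative and, every density having mass one, raises each
    integral by exactly [c]. Fatou's lemma then applies to the shifted products, whose lower limit
    is controlled by [limn_einf_mul_ge]. *)
Lemma fatou_prob_density (G_ : nat -> T -> \bar R) G (k_ : nat -> T -> R) k
    (c b : R) :
  (forall n, measurable_fun [set: T] (G_ n)) -> measurable_fun [set: T] G ->
  (forall n, prob_density mu (k_ n)) -> prob_density mu k ->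
  (forall n x, (- c)%:E <= G_ n x)%E -> (forall x, (- c)%:E <= G x)%E ->
  0 <= c ->
  {ae mu, forall x, forall a : \bar R, (a < G x)%E ->
    \forall n \near \oo, (a < G_ n x)%E} ->
  {ae mu, forall x, k_ n x @[n --> \oo] --> k x} ->
  (forall n, \int[mu]_x (G_ n x * (k_ n x)%:E) <= b%:E)%E ->
  (\int[mu]_x (G x * (k x)%:E) <= b%:E)%E.
Proof.
move=> mG_ mG k_P kP G_c Gc c0 G_G k_k Gb.
have mk_ n := prob_density_measurable (k_P n).
have mk := prob_density_measurable kP.
have k_0 n x : 0 <= k_ n x by case: (k_P n).
have k0 x : 0 <= k x by case: kP.
have shift0 (y : \bar R) : ((- c)%:E <= y -> 0 <= y + c%:E)%E.
  by move=> /(leeD2r c%:E); rewrite -EFinD addNr.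
rewrite -(leeD2rE _ _ (_ : c%:E \is a fin_num))//.
rewrite -integral_prob_density_shift//.
pose F n x := ((G_ n x + c%:E) * (k_ n x)%:E)%E.
have mF n : measurable_fun [set: T] (F n).
  apply: emeasurable_funM; last exact/measurable_EFinP.
  exact: emeasurable_funD.
have F0 n x : (0 <= F n x)%E by rewrite mule_ge0 ?shift0 ?lee_fin.
apply: (@le_trans _ _ (\int[mu]_x limn_einf (F ^~ x))%E).
  apply: ae_ge0_le_integral => //.
  - by move=> x _; rewrite mule_ge0 ?shift0 ?lee_fin.
  - apply: emeasurable_funM; last exact/measurable_EFinP.
    exact: emeasurable_funD.
  - by move=> x _; apply: limf_einf_ge; apply: nearW.
  - have := @measurable_fun_limn_esup _ _ _ setT (fun n x => - F n x)%E.
    move=> /(_ (fun n => measurableT_comp (@oppe_measurable _ _) (mF n))).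
    by move=> /(measurableT_comp (@oppe_measurable _ _)).
  - apply: filterS2 G_G k_k => x Gx kx _.
    apply: limn_einf_mul_ge => //; last 1 first.
    + move=> a; rewrite -lteBlDr// => /Gx; apply: filterS => n.
      by rewrite lteBlDr.
    + by move=> n; rewrite shift0.
apply: le_trans (fatou mu measurableT mF _) _ => //.
(* A lower limit above [b + c] would already put the shifted integral of some index [n] above
   [b + c]. *)
rewrite leNgt; apply/negP => /limf_einf_gt /filter_ex[n].
by rewrite ltNge integral_prob_density_shift// leeD2r.
Qed.

End density_integral.

(** * Integrability of products with conjugate exponents *)

Section Lspace_duality.
Context (d : measure_display) (T : measurableType d) (R : realType).
Variable mu : {measure set T -> \bar R}.

(* [G] may be infinite, so the finite-exponent case dominates [G h] by
   [|G|^r + |h|^p] (Young) instead of using Hoelder's inequality. *)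
Lemma integrable_mul_Lspace (p r : \bar R) (p1 : (1 <= p)%E)
    (G : T -> \bar R) (h : LspaceType mu p1) :
  (r^-1 + p^-1 = 1)%E -> eLfun mu r G ->
  mu.-integrable setT (fun x => G x * (h x)%:E)%E.
Proof.
move=> rp [mG NG].
have mh : measurable_fun [set: T] (fun x => (h x)%:E).
  by apply/measurable_EFinP; exact: Lspace_measurable.
have mGh : measurable_fun [set: T] (fun x => G x * (h x)%:E)%E.
  exact: emeasurable_funM.
have mG1 : measurable_fun [set: T] (fun x => `|G x|)%E.
  exact: measurableT_comp.
have mh1 : measurable_fun [set: T] (fun x => `|(h x)%:E|)%E.
  exact: measurableT_comp.
have Nh : ('N[mu]_p[EFin \o h] < +oo)%E.
  by rewrite -[X in (X < _)%E](Lspace_normE h) ltry.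
apply/integrableP; split => //.
suff [B [mB B0 iB GB]] : exists B : T -> \bar R,
    [/\ measurable_fun [set: T] B, (forall x, 0 <= B x)%E,
        (\int[mu]_x B x < +oo)%E &
        {ae mu, forall x, (`|G x * (h x)%:E| <= B x)%E}].
  apply: le_lt_trans iB; apply: ae_ge0_le_integral => //.
  - exact: measurableT_comp.
  - by apply: filterS GB.
clear mGh.
(* For the endpoint pairs of exponents, 1 and [+oo], the dominating function is the absolute value
   of the integrable factor times the essential bound of the other. *)
case: p p1 h rp mh mh1 Nh => [p||] // p1 h rp mh mh1 Nh; last first.
  have r1 : r = 1%E.
    by apply/eqP; rewrite -inve_eq1; move: rp; rewrite invey adde0 => ->.
  rewrite r1 Lnorm1 in NG.
  exists (fun x => `|G x| * 'N[mu]_+oo[EFin \o h])%E; split.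
  - exact: emeasurable_funM.
  - by move=> x; rewrite mule_ge0// Lnorm_ge0.
  - rewrite ge0_integralZr ?Lnorm_ge0//.
    by rewrite lte_mul_pinfty ?integral_ge0// ge0_fin_numE ?integral_ge0.
  - apply: filterS (ae_le_Lnormy mu (fun x => (h x)%:E)) => x hx.
    by rewrite abseM lee_wpmul2l.
have p1' : 1 <= p by rewrite -lee_fin.
have p0 : 0 < p by rewrite (lt_le_trans ltr01).
have pE : (p%:E^-1 = p^-1%:E)%E by rewrite inver gt_eqF.
rewrite pE in rp.
case: r rp NG => [r||] rp NG; last 2 first.
- have pe : p = 1.
    by move: rp; rewrite invey add0e => -[] /(congr1 GRing.inv);
      rewrite invrK invr1.
  subst p; rewrite Lnorm1 in Nh.
  exists (fun x => 'N[mu]_+oo[G] * `|(h x)%:E|)%E; split.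
  - exact: emeasurable_funM.
  - by move=> x; rewrite mule_ge0// Lnorm_ge0.
  - rewrite ge0_integralZl ?Lnorm_ge0//.
    by rewrite lte_mul_pinfty ?Lnorm_ge0// ge0_fin_numE ?Lnorm_ge0.
  - apply: filterS (ae_le_Lnormy mu G) => x Gx.
    by rewrite abseM lee_wpmul2r.
- by move: rp; rewrite inveNy.
move: rp; rewrite inver; case: ifPn => [//|rn0] [rp].
(* The exponent relation leaves the sign of [r] open; [1 <= p] makes [r^-1] nonnegative. Then
   [r^-1 <= 1] gives [1 <= r], which allows the divisors in Young's inequality to be dropped. *)
have r0 : 0 < r.
  rewrite -invr_gt0 lt_neqAle eq_sym invr_eq0 rn0/=.
  have -> : r^-1 = 1 - p^-1 by rewrite -rp addrK.
  by rewrite subr_ge0 invf_le1.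
have r1 : 1 <= r.
  rewrite -[r]invrK -[leLHS]invr1 lef_pV2 ?posrE ?invr_gt0//.
  by rewrite -rp lerDl invr_ge0 ltW.
have iG : (\int[mu]_x `|G x| `^ r < +oo)%E.
  by rewrite -poweR_Lnorm ?gt_eqF// poweR_lty.
have ih : (\int[mu]_x `|(h x)%:E| `^ p < +oo)%E.
  by rewrite -poweR_Lnorm ?gt_eqF// poweR_lty.
have mpow (f : T -> \bar R) (a : R) : measurable_fun [set: T] f ->
    measurable_fun [set: T] (fun x => f x `^ a)%E.
  move=> mf; apply: (@measurableT_comp _ _ _ _ _ _ (@poweR R ^~ a)) => //.
  exact: measurable_poweR.
exists (fun x => `|G x| `^ r + `|(h x)%:E| `^ p)%E; split.
- by apply: emeasurable_funD; exact: mpow.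
- by move=> x; rewrite adde_ge0// poweR_ge0.
- rewrite ge0_integralD//; first exact: lte_add_pinfty.
  + by move=> x _; rewrite poweR_ge0.
  + exact: mpow.
  + by move=> x _; rewrite poweR_ge0.
  + exact: mpow.
- apply: nearW => x; rewrite abseM.
  (* Where [G] is infinite, so is [|G|^r], and the bound is trivial. *)
  case: (G x) => [y||] /=; rewrite ?poweRyr ?gt_eqF//; last 2 first.
  + by rewrite addye ?leey// gt_eqF// (lt_le_trans _ (poweR_ge0 _ _)).
  + by rewrite addye ?leey// gt_eqF// (lt_le_trans _ (poweR_ge0 _ _)).
  rewrite lee_fin.
  apply: le_trans (conjugate_powR (normr_ge0 _) (normr_ge0 _) r0 p0 rp) _.
  by apply: lerD; rewrite ler_pdivrMr// ler_peMr// powR_ge0.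
Qed.

End Lspace_duality.

(** * Weak convergence and lower semicontinuity of the integral functional along densities *)

Lemma cvg_weak_cvg (R : realType) (X : normedModType R) (x_ : R -> X) (x : X) :
  x_ @ 0^'+ --> x -> weak_cvg x_ x.
Proof. by move=> xx phi cphi; apply: cvg_comp xx (cphi x). Qed.

Section integral_functional.
Context (d : measure_display) (Xi : measurableType d) (R : realType).
Variables (mu : {measure set Xi -> \bar R}) (q : \bar R) (q1 : (1 <= q)%E).
Local Notation L := (LspaceType mu q1).

Lemma eq_ae_integral_mul (G : Xi -> \bar R) (h k : Xi -> R) :
  measurable_fun [set: Xi] G -> measurable_fun [set: Xi] h ->
  measurable_fun [set: Xi] k -> h = k %[ae mu] ->
  (\int[mu]_x (G x * (h x)%:E) = \int[mu]_x (G x * (k x)%:E))%E.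
Proof.
move=> mG mh mk hk; apply: ae_eq_integral => //.
- by apply: emeasurable_funM => //; exact/measurable_EFinP.
- by apply: emeasurable_funM => //; exact/measurable_EFinP.
- by apply: filterS hk => x /[apply] /= ->.
Qed.

(** The functionals add representatives pointwise, while membership in [Pdens] concerns the class
    [u + v]; the two integrands agree a.e. *)
Lemma integral_mul_LspaceD (G : Xi -> \bar R) (u v : L) :
  measurable_fun [set: Xi] G ->
  (\int[mu]_x (G x * (u x + v x)%:E) =
   \int[mu]_x (G x * ((u + v : L) x)%:E))%E.
Proof.
move=> mG; apply: (@eq_ae_integral_mul _ (fun x => u x + v x)) => //.
- by apply: measurable_funD; exact: Lspace_measurable.
- exact: Lspace_measurable.
- by apply: filterS (LspaceD u v) => x h _; rewrite (h I).
Qed.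

Lemma le_integral_Pdens (G : Xi -> \bar R) (h : L) (c : R) :
  measurable_fun [set: Xi] G -> Pdens h -> 0 <= c ->
  (forall x, (- c)%:E <= G x)%E ->
  ((- c)%:E <= \int[mu]_x (G x * (h x)%:E))%E.
Proof.
move=> mG [k kP hk] c0 Gc.
rewrite (eq_ae_integral_mul mG _ _ hk); first exact: le_integral_prob_density.
- exact: Lspace_measurable.
- exact: prob_density_measurable kP.
Qed.

(** The type of [t] depends on [q], so its norm is abstracted to a real number before [q] is
    replaced. *)
Lemma penalty_fin (q' theta : R) (t : L) : q = q'%:E ->
  penalty theta t = theta / q' * `|t| `^ q'.
Proof. by rewrite /penalty; move: `|t| => N ->. Qed.

Lemma penalty_oo (theta : R) (t : L) : q = +oo%E ->
  penalty theta t = theta * `|t|.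
Proof. by rewrite /penalty; move: `|t| => N ->. Qed.

Lemma penalty_ge0 (theta : R) (t : L) : 0 <= theta -> 0 <= penalty theta t.
Proof.
move=> theta0; have := q1; have := normr_ge0 t.
rewrite /penalty; move: `|t| => N; case: (q) => [q'||] N0 q'1.
- rewrite mulr_ge0 ?powR_ge0// divr_ge0//.
  by move: q'1; rewrite lee_fin; apply: le_trans.
- by rewrite mulr_ge0.
- by rewrite mulr_ge0.
Qed.

Variables (U Z : normedModType R) (s : Xi -> Z -> U) (g : U -> \bar R) (c : R).
Hypotheses (hS : assumption_S mu s) (g_lsc : weakly_seq_lsc g).
Hypotheses (c_ge0 : 0 <= c) (g_ge : forall u, ((- c)%:E <= g u)%E).
Hypothesis g_meas : forall z, measurable_fun [set: Xi] (fun xi => g (s xi z)).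

(* Otherwise the bound fails along a sequence [e_n] tending to 0 so fast that
   the densities converge a.e., which contradicts Fatou's lemma. *)
Lemma integral_Pdens_lsc (z_ : R -> Z) (z : Z) (h_ : R -> L) (h : L) (b : R) :
  weak_cvg z_ z -> h_ @ 0^'+ --> h -> Pdens h ->
  (b%:E < \int[mu]_xi (g (s xi z) * (h xi)%:E))%E ->
  \forall e \near (0 : R)^'+, Pdens (h_ e) ->
    (b%:E <= \int[mu]_xi (g (s xi (z_ e)) * (h_ e xi)%:E))%E.
Proof.
move=> zz hh [k kP hk] bh; apply: contrapT => nnear.
(* The rate [2^-(n+1)] is the one [Lspace_ae_cvg] asks for; [e < 1/(n+1)] drives the sequence to
   0. *)
have /choice[e_ e_P] : forall n : nat, exists e : R,
    [/\ 0 < e, e < n.+1%:R^-1, `|h_ e - h| <= (2 ^ (n + 1))%:R^-1,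
        Pdens (h_ e) &
        (\int[mu]_xi (g (s xi (z_ e)) * (h_ e xi)%:E) <= b%:E)%E].
  move=> n; apply: contrapT => nex; apply: nnear.
  have h_near : \forall e \near (0 : R)^'+, `|h_ e - h| <= (2 ^ (n + 1))%:R^-1.
    have /cvgrPdistC_le := hh; apply.
    by rewrite invr_gt0 ltr0n expn_gt0.
  have e_lt : \forall e \near (0 : R)^'+, e < n.+1%:R^-1.
    by apply: nbhs_right_lt; rewrite invr_gt0.
  have e_gt : \forall e \near (0 : R)^'+, 0 < e by exact: nbhs_right_gt.
  apply: filterS3 e_gt e_lt h_near => e e0 en hen hP.
  by rewrite leNgt; apply/negP => /ltW ltb; apply: nex; exists e.
have e_cvg : e_ @ \oo --> (0 : R)^'+.
  have e0 : e_ @ \oo --> (0 : R).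
    apply/cvgrPdist_lt => e egt0; near=> n.
    have [en0 en _ _ _] := e_P n.
    rewrite sub0r normrN gtr0_norm//; apply: lt_trans en _.
    by near: n; exact: (near_infty_natSinv_lt (PosNum egt0)).
  move=> A A0; change (\forall n \near \oo, A (e_ n)).
  have : \forall n \near \oo, 0 < e_ n -> A (e_ n) := e0 _ A0.
  by apply: filterS => n; apply; case: (e_P n).
(* The classes are replaced by densities that are nonnegative everywhere, as the Fatou argument
   requires. *)
have /choice[k_ k_P] : forall n, exists k : Xi -> R,
    prob_density mu k /\ h_ (e_ n) = k %[ae mu].
  by move=> n; case: (e_P n) => _ _ _ [k' kP' hk'] _; exists k'.
have k_ae : {ae mu, forall x, k_ n x @[n --> \oo] --> k x}.
  have : {ae mu, forall x, h_ (e_ n) x @[n --> \oo] --> h x}.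
    by apply: Lspace_ae_cvg => n; case: (e_P n).
  have := ae_foralln (fun n => (k_P n).2).
  apply: filterS3 hk => x hkx hkn.
  rewrite (hkx I) (_ : (fun n => h_ (e_ n) x) = (fun n => k_ n x))//.
  by apply/funext => n; rewrite (hkn n I).
(* For a.e. [xi], assumption (S) gives weak convergence in [U]; lower semicontinuity of [g] bounds
   the whole family, and [e_cvg] passes this to the sequence. *)
have G_ae : {ae mu, forall xi, forall a : \bar R, (a < g (s xi z))%E ->
    \forall n \near \oo, (a < g (s xi (z_ (e_ n))))%E}.
  case: hS => _ /(_ _ _ zz); apply: filterS => xi /g_lsc gxi a ag.
  exact: (e_cvg _ (limf_einf_gt (lt_le_trans ag gxi))).
move: bh; rewrite ltNge => /negP; apply.
rewrite (eq_ae_integral_mul (g_meas z) _ _ hk); last 2 first.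
- exact: Lspace_measurable.
- exact: prob_density_measurable kP.
apply: (fatou_prob_density _ _ _ _ _ _ c_ge0 G_ae k_ae) => //.
- by move=> n; case: (k_P n).
- move=> n; have [kn hkn] := k_P n.
  rewrite -(eq_ae_integral_mul (g_meas _) _ _ hkn).
  + by case: (e_P n).
  + exact: Lspace_measurable.
  + exact: prob_density_measurable kn.
Unshelve. all: by end_near. Qed.

End integral_functional.

Theorem theorem3p1 (R : realType) (U Z : completeNormedModType R)
    (d : measure_display) (Xi : measurableType d)
    (mu : {sigma_finite_measure set Xi -> \bar R})
    (Pr : probability Xi R) (Pr_mu : Pr `<< mu)
    (f0 : Z -> \bar R) (s : Xi -> Z -> U) (g : U -> \bar R)
    (hS : assumption_S mu s) (hFG : assumption_FG f0 g)
    (q : \bar R) (q1 : (1 <= q)%E)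
    (rho : LspaceType mu q1)
    (rho_density :
       EFin \o rho = 'd (charge_of_finite_measure Pr) '/d mu %[ae mu])
    (rho_P : Pdens rho)
    (rho_ : R -> LspaceType mu q1)
    (rho_eP : forall e : R, 0 < e -> Pdens (rho_ e))
    (rho_cvg : rho_ @ 0^'+ --> rho)
    (theta_ : R -> R) (theta_gt0 : forall e : R, 0 < e -> 0 < theta_ e)
    (theta_cvg : theta_ @ 0^'+ --> +oo)
    (theta_rho_fin : forall q' : R, q = q'%:E ->
       theta_ e * `|rho_ e - rho| `^ q' @[e --> 0^'+] --> (0 : R))
    (theta_rho_oo : q = +oo%E ->
       theta_ e * `|rho_ e - rho| @[e --> 0^'+] --> (0 : R))
    (r : \bar R) (rq : (r^-1 + q^-1 = 1)%E)
    (gs_Lr : forall z : Z, eLfun mu r (fun xi => g (s xi z))) :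
  Gamma_s_cvg (Phi_eps f0 s g rho_ theta_) (Phi f0 s g rho).
Proof.
have [[f0_gtNy _] [f0_lsc g_lsc] [gamma g_gamma]] := hFG.
(* Weakening [gamma] to [- |gamma|] makes the shift constant [c = |gamma|] nonnegative. *)
have g_ge u : ((- `|gamma|)%:E <= g u)%E.
  by apply: le_trans (g_gamma u); rewrite lee_fin lerNnormlW.
have c0 := normr_ge0 gamma.
have g_meas z : measurable_fun [set: Xi] (fun xi => g (s xi z)).
  by case: (gs_Lr z).
have PhiepsE e z t : Phi_eps f0 s g rho_ theta_ e (z, t) =
    (f0 z + \int[mu]_xi (g (s xi z) * ((rho_ e + t)%R xi)%:E)
       + (penalty (theta_ e) t)%:E + iota_P (rho_ e + t)%R)%E.
  by rewrite /Phi_eps integral_mul_LspaceD.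
have e_gt0 : \forall e \near (0 : R)^'+, 0 < e by exact: nbhs_right_gt.
have q_cases : (exists q', q = q'%:E) \/ q = +oo%E.
  by have := q1; case: (q) => [q'||] // _; [left; exists q'|right].
split=> [[z t]|[z t] x_ x_cvg].

(* The recovery sequence *)
- rewrite /Phi; case: asboolP => [t0|_]; last first.
    by exists (fun=> (z, t)); [exact: cvg_cst|rewrite leey].
  have {}t0 : t = 0.
    apply: Lspace_eqP; apply: filterS2 t0 (Lspace0 mu q1) => x tx zx _.
    by rewrite tx (zx I).
  (* With this choice the density in [Phi_eps] is exactly [rho]: the integral is that of [Phi], the
     indicator is 0, and only the penalty remains. *)
  exists (fun e => (z, rho - rho_ e)).
    have t_cvg : rho - rho_ e @[e --> 0^'+] --> t.
      by rewrite t0 -(subrr rho); apply: cvgB rho_cvg; exact: cvg_cst.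
    exact: (@cvg_pair _ _ _ _ (nbhs z) (nbhs t) _ _ _ _ _ (cvg_cst z) t_cvg).
  have pen_cvg : penalty (theta_ e) (rho - rho_ e) @[e --> 0^'+] --> (0 : R).
    have [[q' qE]|qE] := q_cases.
      under eq_fun do rewrite (penalty_fin _ _ qE) distrC mulrAC.
      have := cvgM (theta_rho_fin _ qE) (cvg_cst q'^-1); rewrite mul0r.
      exact.
    under eq_fun do rewrite (penalty_oo _ _ qE) distrC.
    exact: theta_rho_oo.
  rewrite integral_mul_LspaceD// t0 addr0.
  apply/lee_addgt0Pr => eps eps0.
  apply: limf_esup_le.
  apply: filterS2 e_gt0 (cvgr_lt _ pen_cvg _ eps0) => e e0 pe.
  have rhoE : rho_ e + (rho - rho_ e) = rho by rewrite addrC subrK.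
  rewrite PhiepsE rhoE /iota_P asboolT// adde0.
  by apply: leeD2l; rewrite lee_fin ltW.

(* The lower bound along strongly convergent families *)
have z_cvg : (x_ e).1 @[e --> 0^'+] --> z.
  exact: (cvg_comp x_ fst x_cvg (@cvg_fst _ _ (nbhs z) (nbhs t) _)).
have t_cvg : (x_ e).2 @[e --> 0^'+] --> t.
  exact: (cvg_comp x_ snd x_cvg (@cvg_snd _ _ (nbhs z) (nbhs t) _)).
have h_cvg : rho_ e + (x_ e).2 @[e --> 0^'+] --> rho + t by exact: cvgD.
have f0_near (a : R) : (a%:E < f0 z)%E ->
    \forall e \near (0 : R)^'+, (a%:E < f0 (x_ e).1)%E.
  move=> az; apply: limf_einf_gt; apply: lt_le_trans az _.
  exact: f0_lsc (cvg_weak_cvg z_cvg).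
(* As [-oo + +oo = -oo], [iota_P = +oo] forces [Phi_eps = +oo] only because the
   integral is finite. *)
have int_fin e z' : (\int[mu]_xi (g (s xi z')
    * ((rho_ e + (x_ e).2)%R xi)%:E))%E \is a fin_num.
  apply: integrable_fin_num => //.
  exact: integrable_mul_Lspace rq (gs_Lr z').
have Phi_not_P e : ~ Pdens (rho_ e + (x_ e).2) ->
    Phi_eps f0 s g rho_ theta_ e (x_ e) = +oo%E.
  move=> nP; rewrite (surjective_pairing (x_ e)) PhiepsE.
  rewrite /iota_P asboolF// addey//.
  rewrite -(fineK (int_fin _ _)) !adde_eq_ninfty/= !orbF.
  by rewrite gt_eqF ?f0_gtNy.
rewrite /Phi; case: asboolP => [t0|tn0]; last first.
  have {}tn0 : 0 < `|t|.
    rewrite normr_gt0; apply/eqP => t0; apply: tn0; rewrite t0.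
    by apply: filterS (Lspace0 mu q1) => x; apply.
  have pen_cvg : penalty (theta_ e) (x_ e).2 @[e --> 0^'+] --> +oo.
    (* The norm of [(x_ e).2] is eventually at least [|t| / 2], which gives a fixed positive factor
       of [theta_ e]. *)
    have [K K0 penK] : exists2 K, 0 < K & \forall e \near (0 : R)^'+,
        theta_ e * K <= penalty (theta_ e) (x_ e).2.
      have t2 : 0 < `|t| / 2 by rewrite divr_gt0.
      have tN : \forall e \near (0 : R)^'+, `|t| / 2 <= `|(x_ e).2|.
        apply: (cvgr_ge _ (cvg_norm t_cvg)).
        by rewrite ltr_pdivrMr// ltr_pMr// ltr1n.
      have [[q' qE]|qE] := q_cases.
        have q'0 : 0 < q'.
          by have := q1; rewrite qE lee_fin; apply: lt_le_trans.
        exists ((`|t| / 2) `^ q' / q'); first by rewrite divr_gt0// powR_gt0.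
        apply: filterS2 e_gt0 tN => e e0 te.
        rewrite (penalty_fin _ _ qE) mulrA mulrAC.
        apply: ler_wpM2l.
          by rewrite divr_ge0 ?(ltW q'0)// ltW// theta_gt0.
        by apply: ge0_ler_powR; rewrite ?nnegrE ?(ltW q'0) ?(ltW t2).
      exists (`|t| / 2) => //; apply: filterS2 e_gt0 tN => e e0 te.
      by rewrite (penalty_oo _ _ qE) ler_wpM2l// ltW// theta_gt0.
    apply/cvgryPge => A; have /cvgryPge /(_ (A / K)) := theta_cvg.
    apply: filterS2 penK => e pe Ae; apply: le_trans pe.
    by rewrite -ler_pdivrMr.
  have [a az] : exists a : R, (a%:E < f0 z)%E by exact: EFin_lt_ex.
  apply: lee_EFin_lt => b _; apply: limf_einf_ge.
  (* This threshold complements the bounds [a] on [f0] and [- |gamma|] on the integral, so that the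
     three add up to [b]. *)
  have /cvgryPge /(_ (b - a + `|gamma|)) := pen_cvg.
  apply: filterS2 (f0_near _ az) => e ae pe.
  have [P|/Phi_not_P ->] := pselect (Pdens (rho_ e + (x_ e).2)); last first.
    by rewrite leey.
  rewrite (surjective_pairing (x_ e)) PhiepsE /iota_P asboolT// adde0.
  have -> : b = a + (- `|gamma|) + (b - a + `|gamma|).
    by rewrite [RHS]addrC addrACA subrK subrr addr0.
  rewrite !EFinD; apply: leeD; last by rewrite -EFinB -EFinD lee_fin.
  apply: leeD; first exact: ltW.
  exact: le_integral_Pdens.
have {}t0 : t = 0.
  apply: Lspace_eqP; apply: filterS2 t0 (Lspace0 mu q1) => x tx zx _.
  by rewrite tx (zx I).
rewrite integral_mul_LspaceD// t0 addr0.
(* Neither summand is [-oo]: [f0] by properness, the integral by the lower bound on [g]. *)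
apply: lee_add_EFin_lt => //.
  by apply: lt_le_trans (le_integral_Pdens _ rho_P c0 _) => //; rewrite ltNyr.
move=> a b az bI; apply: limf_einf_ge.
have h_cvg0 : rho_ e + (x_ e).2 @[e --> 0^'+] --> rho.
  by rewrite -[rho]addr0 -t0.
have := integral_Pdens_lsc hS g_lsc c0 g_ge g_meas (cvg_weak_cvg z_cvg)
  h_cvg0 rho_P bI.
apply: filterS3 e_gt0 (f0_near _ az) => e e0 ae be.
have [P|/Phi_not_P ->] := pselect (Pdens (rho_ e + (x_ e).2)); last first.
  by rewrite leey.
rewrite (surjective_pairing (x_ e)) PhiepsE /iota_P asboolT// adde0.
rewrite -[leLHS]adde0 EFinD; apply: leeD; last first.
  by rewrite lee_fin penalty_ge0// ltW// theta_gt0.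
apply: leeD; first exact: ltW.
exact: be.
Qed.
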